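(* If $(H,\pi)$ is an elementary homomorphic image of a signed graph $(G,\sigma)$, then $$\psi(G,\sigma)-4\le\psi(H,\pi)\le\psi(G,\sigma).$$ Furthermore, the lower bound can be attained; in particular, for every integer $k\ge8$ there exist a signed graph $(G,\sigma)$ with $\psi(G,\sigma)=k$ and an elementary homomorphic image $(H,\pi)$ of it with $\psi(H,\pi)=k-4$.
   Context: A signed graph $(G,\sigma)$ is a finite simple graph $G$ with a signature $\sigma:E(G)\to\{-,+\}$. Switching a set $S\subseteq V(G)$ changes the sign of every edge with exactly one end in $S$; two signed graphs on the same underlying graph are equivalent if one is obtained from the other by switching some set of vertices. For $k\ge1$ let $M_k=\{-n,\dots,-1,+1,\dots,+n\}$ if $k=2n$, and $M_k=\{-n,\dots,-1,\pm0,+1,\dots,+n\}$ if $k=2n+1$, where $\pm0$ is a single colour with $-(\pm0)=\pm0$. A $k$-colouring of $(G,\sigma)$ is a map $\phi:V(G)\to M_k$. Let $K_k^*$ be the signed multigraph with vertex set $\{i\ge 0: +i\in M_k\}$ (vertex $0$ standing for colour $\pm0$ when $k$ is odd), in which every two distinct vertices are joined by exactly one positive and one negative edge, and every vertex $i\neq0$ carries exactly one negative loop. Given a $k$-colouring $\phi$, the reduced signed graph $R(G,\sigma,\phi)$ is obtained by (1) switching every vertex with a negative colour $-i$ and recolouring it $+i$; (2) identifying, for each $i$, all vertices of colour $+i$ (resp. $\pm0$) into a single vertex $i$ (resp. $0$), edges inside a class becoming loops; (3) keeping at most one positive and at most one negative edge (or loop) between any two vertices (or at any vertex). The colouring $\phi$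 is complete if $R(G,\sigma,\phi)$ is exactly $K_k^*$. The achromatic number $\psi(G,\sigma)$ is the largest $k\ge1$ such that some signed graph equivalent to $(G,\sigma)$ admits a complete $k$-colouring. Two vertices $u,v$ of $(G,\sigma)$ are identifiable if they are non-adjacent and, after possibly switching $u$ or $v$, $\sigma(uw)=\sigma(vw)$ for every common neighbour $w$ of $u$ and $v$. An elementary homomorphic image of $(G,\sigma)$ is the signed graph obtained from $(G,\sigma)$ (after this possible switching) by identifying two identifiable vertices $u,v$ into a single vertex adjacent to all neighbours of $u$ and of $v$, each such edge keeping its sign (the result being simple). *)

(* Defs.v *)
From mathcomp Require Import all_boot all_order all_algebra.
From mathcomp Require Import boolp.
Set Implicit Arguments.
Unset Strict Implicit.
Unset Printing Implicit Defensive.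

(* [sg_neg u v] is the sign of the edge uv: true for -, false for +.  Its
   values on non-adjacent pairs are junk, never inspected below.  *)
Record sgraph := SGraph {
  sg_vert :> finType;
  sg_adj : rel sg_vert;
  sg_neg : sg_vert -> sg_vert -> bool;
  sg_adj_sym : symmetric sg_adj;
  sg_adj_irr : irreflexive sg_adj;
  sg_neg_sym : forall u v, sg_adj u v -> sg_neg u v = sg_neg v u
}.

Section Switching.
Variables (G : sgraph) (S : {set G}).

Definition switch_neg (u v : G) : bool :=
  ((u \in S) (+) (v \in S)) (+) sg_neg u v.

Lemma switch_neg_sym u v : sg_adj u v -> switch_neg u v = switch_neg v u.
Proof. by move=> uv; rewrite /switch_neg (addbC (u \in S)) sg_neg_sym. Qed.

Definition switch : sgraph :=
  SGraph (@sg_adj_sym G) (@sg_adj_irr G) switch_neg_sym.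
End Switching.

(* The colours are integers, the colour ±0 being the integer 0. *)
Definition M (k : nat) : pred int :=
  [pred c | (`|c| <= k./2)%N && ((c != 0%R) || odd k)].

Definition colouring (G : sgraph) (k : nat) (phi : G -> int) : Prop :=
  forall v, phi v \in M k.

(* Signed multigraphs on natural numbers with at most one positive and at most
   one negative edge between two vertices, and at most one positive and at most
   one negative loop at a vertex: [mg_edge s i j] tells whether the edge (the
   loop if i = j) of sign s is present, with true for -.  *)
Record smgraph := SMGraph {
  mg_vert : pred nat;
  mg_edge : bool -> rel nat
}.

Definition smgraph_eq (A B : smgraph) : Prop :=
  mg_vert A =1 mg_vert B /\ forall s, mg_edge A s =2 mg_edge B s.

Definition Kstar (k : nat) : smgraph := {|
  mg_vert := fun i => Posz i \in M k;
  mg_edge := fun s i j =>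
    [&& Posz i \in M k, Posz j \in M k & (i == j) ==> (s && (i != 0))]
|}.

(* After switching the vertices of negative colour, the vertex v is recoloured
   by the absolute value of its colour.  *)
Definition reduced (G : sgraph) (phi : G -> int) : smgraph :=
  let G' := switch [set v : G | (phi v < 0)%R] in
  let c (v : G') : nat := `|phi v|%N in
  {| mg_vert := fun i => [exists v : G', c v == i];
     mg_edge := fun s i j =>
       [exists u : G', exists v : G',
          [&& sg_adj u v, sg_neg u v == s, c u == i & c v == j]] |}.

Definition complete_colouring (G : sgraph) (k : nat) (phi : G -> int) : Prop :=
  colouring k phi /\ smgraph_eq (reduced phi) (Kstar k).

Definition admits_complete (G : sgraph) (k : nat) : Prop :=
  exists (S : {set G}) (phi : switch S -> int), complete_colouring k phi.

(* The range of k is no restriction: see [psi_max]. *)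
Definition psi (G : sgraph) : nat :=
  \max_(k < (#|G|.*2).+2 | (0 < k) && `[< admits_complete G k >]) k.

Lemma admits_complete_bound (G : sgraph) k :
  admits_complete G k -> k < (#|G|.*2).+2.
Proof.
case=> S [phi [_ [Hv _]]].
suff H : k./2 <= #|G|.
  by rewrite -{1}(odd_double_half k) ltnS -add1n leq_add ?leq_b1 // leq_double.
have sub : {subset iota 1 k./2 <= [seq `|phi v|%N | v <- enum G]}.
  move=> i; rewrite mem_iota add1n ltnS => /andP[i0 ik].
  have: mg_vert (Kstar k) i by rewrite /= inE /= ik eqz_nat -lt0n i0.
  rewrite -Hv => /existsP[v /eqP <-]; apply/mapP.
  by exists v => //; rewrite mem_enum.
have := uniq_leq_size (iota_uniq 1 k./2) sub.
by rewrite size_iota size_map -cardE.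
Qed.

Lemma psi_max (G : sgraph) k : admits_complete G k -> k <= psi G.
Proof.
case: k => // k Hk; have lt := admits_complete_bound Hk.
by apply: (@leq_bigmax_cond _ _ _ (Ordinal lt)); apply/asboolP.
Qed.

Lemma psi_admits (G : sgraph) k :
  0 < k -> admits_complete G k -> 0 < psi G /\ admits_complete G (psi G).
Proof.
move=> k0 Hk; have lt := admits_complete_bound Hk.
pose P (i : 'I_(#|G|.*2).+2) := (0 < i) && `[< admits_complete G i >].
have Pk : P (Ordinal lt) by rewrite /P k0; apply/asboolP.
rewrite /psi (@bigmax_eq_arg _ (Ordinal lt) P _ Pk).
by case: arg_maxnP => // i /andP[i0 /asboolP].
Qed.

Definition identifiable_by (G : sgraph) (S : {set G}) (u v : G) : Prop :=
  [/\ u != v, ~~ sg_adj u v, [\/ S = set0, S = [set u] | S = [set v]]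
    & forall w, sg_adj u w -> sg_adj v w -> switch_neg S u w = switch_neg S v w].

(* H is obtained, up to isomorphism, from G by identifying u and v, the map f
   being the quotient map.  *)
Definition identification (G H : sgraph) (u v : G) (f : G -> H) : Prop :=
  [/\ forall a : H, exists x, f x = a,
      forall x y, f x = f y <-> [\/ x = y, x = u /\ y = v | x = v /\ y = u],
      forall a b : H,
        sg_adj a b <-> exists x y, [/\ f x = a, f y = b & sg_adj x y]
    & forall x y, sg_adj x y -> sg_neg (f x) (f y) = sg_neg x y].

Definition elementary_image (G H : sgraph) : Prop :=
  exists (S : {set G}) (u v : G), identifiable_by S u v /\
    exists f : switch S -> H, @identification (switch S) H u v f.

(* Main.v *)
(* Complete colourings pull back along the identification map, whence
   psi(H) <= psi(G).  Conversely, deleting the classes of u and v from a complete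
   colouring of G leaves at least k - 4 colours on a subgraph of H, and a complete
   colouring of an induced subgraph extends to the whole graph without losing
   colours, one vertex at a time.

   For the sharpness, take graphs all of whose edges are negative.  There, the
   ends of an edge inside a class are on the same side of the switching set.
   Hence the whole class of a universal vertex is on one side, all the edges
   between two such classes have the same sign, and so two universal vertices
   always share their class.  Now every nonzero class contains an edge, hence
   meets every vertex cover: a cover of p + 3 vertices, two of them universal,
   allows only p + 2 nonzero classes.  The graph G has p + 4 nonzero classes, one
   for each vertex of a cover, and H is obtained by identifying two of these
   vertices, which together are adjacent to all the others.  *)
Require Import Defs.
From HB Require Import structures.
From mathcomp Require Import all_boot all_algebra.
From mathcomp Require Import boolp zify.
Set Implicit Arguments.
Unset Strict Implicit.
Unset Printing Implicit Defensive.

Lemma exists_notin (s : seq nat) : exists n, n \notin s.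
Proof.
exists (\max_(i <- s) i).+1; apply/negP => /(@leq_bigmax_seq _ s xpredT id).
by move=> /(_ isT); rewrite ltnn.
Qed.

Lemma map_index_uniq (T : eqType) (s : seq T) :
  uniq s -> [seq index x s | x <- s] = iota 0 (size s).
Proof.
case: s => // x0 s us; apply: (@eq_from_nth _ 0); rewrite size_map ?size_iota //.
by move=> i lti; rewrite (nth_map x0) // index_uniq // nth_iota.
Qed.

Definition symdiff (T : finType) (A B : {set T}) : {set T} :=
  [set x | (x \in A) (+) (x \in B)].

Lemma symdiffK (T : finType) (A B : {set T}) : symdiff (symdiff A B) B = A.
Proof. by apply/setP => x; rewrite !inE addbK. Qed.

Section Labels.
Implicit Types (D W : seq nat) (z : nat).

(* A label other than [z] stands for a colour and its opposite.  *)
Definition ncol D z : nat := size D + count (predC1 z) D.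

Definition labels (k : nat) : seq nat := iota (~~ odd k) (uphalf k).

Lemma mem_labels k i : (i \in labels k) = (i <= k./2) && ((i != 0) || odd k).
Proof. by rewrite mem_iota; lia. Qed.

Lemma mem_M k (i : nat) : (Posz i \in M k) = (i \in labels k).
Proof. by rewrite mem_labels inE. Qed.

Lemma count_labels k : count (predC1 0) (labels k) = k./2.
Proof.
have count_pos m : count (predC1 0) (iota 1 m) = m.
  rewrite -[RHS](size_iota 1 m); apply/eqP; rewrite -all_count.
  by apply/allP => i; rewrite mem_iota /= -lt0n; case/andP.
by rewrite /labels uphalf_half; case: (odd k); rewrite ?add1n /= count_pos.
Qed.

Lemma ncol_labels k : ncol (labels k) 0 = k.
Proof. by rewrite /ncol count_labels size_iota; lia. Qed.

Lemma ncol_le_notin D z z' : z' \notin D -> ncol D z <= ncol D z'.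
Proof.
move=> z'D; rewrite leq_add2l; apply: leq_trans (count_size _ _) _.
rewrite leq_eqVlt eq_sym -all_count; apply/orP; left.
by apply/allP => i iD; apply: contraNneq z'D => <-.
Qed.

Lemma ncol_le_filter_notin D W z : uniq D ->
  ncol D z <= ncol [seq i <- D | i \notin W] z + (size W).*2.
Proof.
move=> uD; have count_le a :
    count a D <= count a [seq i <- D | i \notin W] + size W.
  rewrite -(permP (permEl (perm_filterC (fun i => i \notin W) D))) count_cat.
  rewrite leq_add2l; apply: leq_trans (count_size _ _) _; apply: uniq_leq_size.
    exact: filter_uniq.
  by move=> i; rewrite mem_filter /= negbK => /andP[].
have := leq_add (count_le predT) (count_le (predC1 z)).
by rewrite !count_predT addnACA addnn.
Qed.

Lemma perm_map_index_labels D z : uniq D ->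
  perm_eq [seq index i (z :: rem z D) | i <- D] (labels (ncol D z)).
Proof.
move=> uD; have count_rem : count (predC1 z) D = size (rem z D).
  by rewrite -size_filter -rem_filter.
have uzD : uniq (z :: rem z D) by rewrite /= mem_rem_uniqF ?rem_uniq.
have := map_index_uniq uzD; set r := index^~ _.
rewrite /labels /ncol count_rem /=.
have [zD|zD] := boolP (z \in D) => rE.
  have -> : size D = (size (rem z D)).+1 := perm_size (perm_to_rem zD).
  rewrite addSn addnn oddS odd_double [uphalf _]/= doubleK -[iota _ _]rE.
  exact: (perm_map r (perm_to_rem zD)).
rewrite rem_id // in rE *; rewrite addnn odd_double uphalf_double.
by case: rE => _ ->.
Qed.

End Labels.

Section PartialColouring.
Variable G : sgraph.
Implicit Types (S : {set G}) (c : G -> nat) (D : seq nat) (z : nat).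

Definition joined S c (s : bool) (i j : nat) : Prop :=
  exists x y : G, [/\ sg_adj x y, switch_neg S x y = s, c x = i & c y = j].

Definition proper_on S c D z : Prop :=
  forall x y : G, sg_adj x y -> c x = c y -> c x \in D ->
    switch_neg S x y && (c x != z).

(* The vertices whose label is not in [D] are uncoloured; [z] is the label of
   the colour ±0, if it is in [D].  *)
Record partial_complete S c D z : Prop := PartialComplete {
  pc_uniq : uniq D;
  pc_nonempty : forall i, i \in D -> exists x, c x = i;
  pc_proper : proper_on S c D z;
  pc_joined : forall s i j, i \in D -> j \in D ->
    (i == j) ==> (s && (i != z)) -> joined S c s i j
}.

Lemma joinedC S c s i j : joined S c s i j -> joined S c s j i.
Proof.
move=> [x [y [xy <- <- <-]]]; exists y, x.
split=> //; first by rewrite sg_adj_sym.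
by rewrite switch_neg_sym // sg_adj_sym.
Qed.

Lemma eq_joined S S' c c' s i j :
  (forall x, c x = i \/ c x = j -> c' x = c x /\ (x \in S') = (x \in S)) ->
  joined S c s i j -> joined S' c' s i j.
Proof.
move=> eqc [x [y [xy <- cx cy]]]; exists x, y.
have [-> Sx] := eqc x (or_introl cx); have [-> Sy] := eqc y (or_intror cy).
by rewrite /switch_neg Sx Sy.
Qed.

Lemma partial_complete_subset S c D D' z : uniq D' -> {subset D' <= D} ->
  partial_complete S c D z -> partial_complete S c D' z.
Proof.
move=> uD' D'D [_ nonempty proper joined_D].
split=> // [i /D'D|x y xy cxy /D'D|s i j /D'D iD /D'D].
- exact: nonempty.
- exact: proper.
- exact: joined_D.
Qed.

Lemma partial_complete_relabel S c D z (r : nat -> nat) :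
  (forall x, c x \in D) -> {in z :: D &, injective r} ->
  partial_complete S c D z -> partial_complete S (r \o c) (map r D) (r z).
Proof.
move=> coloured r_inj [uD nonempty proper joined_D].
have r_injD : {in D &, injective r}.
  by move=> i j iD jD; apply: r_inj; rewrite inE ?iD ?jD orbT.
have rz i : i \in D -> (r i == r z) = (i == z).
  by move=> iD; rewrite (inj_in_eq r_inj) // inE ?eqxx // iD orbT.
split=> [|_ /mapP[i /nonempty[x <-] ->]|x y xy /r_injD cxy _|s i' j'].
- by rewrite map_inj_in_uniq.
- by exists x.
- by rewrite /= rz // proper // cxy.
- move=> /mapP[i iD ->] /mapP[j jD ->]; rewrite (inj_in_eq r_injD) // rz //.
  move=> /(joined_D s i j iD jD)[x [y [xy sxy cx cy]]].
  by exists x, y; rewrite /= cx cy.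
Qed.

Section Reduced.
Variable phi : G -> int.
Let S : {set G} := [set v | (phi v < 0)%R].
Let c (v : G) : nat := `|phi v|%N.

Lemma reduced_vertP i : reflect (exists v, c v = i) (mg_vert (reduced phi) i).
Proof.
by apply: (iffP existsP) => -[v] => [/eqP|]; exists v => //; apply/eqP.
Qed.

Lemma reduced_edgeP s i j :
  reflect (joined S c s i j) (mg_edge (reduced phi) s i j).
Proof.
apply: (iffP existsP) => [[x /existsP[y]]|[x [y [xy sxy cx cy]]]].
  by case/and4P=> xy /eqP sxy /eqP cx /eqP cy; exists x, y.
by exists x; apply/existsP; exists y; apply/and4P; split=> //; apply/eqP.
Qed.

Lemma complete_colouringP k : complete_colouring k phi <->
  partial_complete S c (labels k) 0 /\ forall v, c v \in labels k.
Proof.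
split=> [[_ [eqV eqE]]|[[_ nonempty proper joined_k] coloured]].
  have labelsE i : (i \in labels k) = mg_vert (reduced phi) i.
    by rewrite eqV -mem_M.
  split=> [|v]; last by rewrite labelsE; apply/reduced_vertP; exists v.
  split=> [|i|x y xy cxy _|s i j iD jD ij].
  - exact: iota_uniq.
  - by rewrite labelsE => /reduced_vertP.
  - have /reduced_edgeP : joined S c (switch_neg S x y) (c x) (c x).
      by exists x, y.
    by rewrite eqE /= eqxx => /and3P[].
  - by apply/reduced_edgeP; rewrite eqE /= !mem_M iD jD.
split; first by move=> v; have := coloured v; rewrite mem_labels inE absz_eq0.
split=> [i|s i j] /=; rewrite !mem_M.
  by apply/reduced_vertP/idP => [[v <-]|/nonempty].
apply/reduced_edgeP/and3P => [[x [y [xy <- <- <-]]]|[]]; last exact: joined_k.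
by split=> //; apply/implyP => /eqP cxy; apply: proper.
Qed.

End Reduced.

End PartialColouring.

Definition full_surjection (G H : sgraph) (f : G -> H) : Prop :=
  (forall a, exists x, f x = a) /\
  (forall a b, sg_adj a b <-> exists x y, [/\ f x = a, f y = b & sg_adj x y]).

Lemma partial_complete_image (G H : sgraph) (f : G -> H)
    (S : {set G}) (S' : {set H}) (c : G -> nat) (c' : H -> nat)
    (D : seq nat) (z : nat) :
    full_surjection f ->
    (forall x y, sg_adj x y -> c x \in D -> c y \in D ->
       switch_neg S' (f x) (f y) = switch_neg S x y) ->
    (forall x, (c x \in D) || (c' (f x) \in D) -> c' (f x) = c x) ->
  partial_complete S c D z <-> partial_complete S' c' D z.
Proof.
move=> [f_surj f_adj] f_neg f_col.
have colG x : c x \in D -> c' (f x) = c x by move=> cx; apply: f_col; rewrite cx.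
have colH x : c' (f x) \in D -> c' (f x) = c x.
  by move=> cx; apply: f_col; rewrite cx orbT.
have adj_f x y : sg_adj x y -> sg_adj (f x) (f y).
  by move=> xy; apply/f_adj; exists x, y.
split=> -[uD nonempty proper joined_D]; split=> //.
- by move=> i /[dup] iD /nonempty[x cx]; exists (f x); rewrite colG ?cx.
- move=> _ _ /f_adj[x [y [<- <- xy]]] cxy cx; have cy := cx; rewrite cxy in cy.
  by rewrite f_neg -?colH // (colH x) //; apply: proper; rewrite -?colH.
- move=> s i j iD jD /(joined_D s i j iD jD)[x [y [xy <- cx cy]]].
  exists (f x), (f y); rewrite !colG ?cx ?cy // f_neg ?cx ?cy //.
  by split=> //; apply: adj_f.
- move=> i /[dup] iD /nonempty[a ca]; have [x xa] := f_surj a.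
  by exists x; rewrite -colH xa ca.
- move=> x y xy cxy cx; have cy := cx; rewrite cxy in cy.
  by rewrite -f_neg // -(colG x) //; apply: proper; rewrite ?colG //; apply: adj_f.
- move=> s i j iD jD /(joined_D s i j iD jD)[_ [_ [/f_adj[x [y [<- <- xy]]] <- cx cy]]].
  exists x, y; rewrite -!colH ?cx ?cy //.
  by split=> //; rewrite f_neg -?colH ?cx ?cy.
Qed.

Section Switching.
Variables (G : sgraph) (S : {set G}).

Lemma partial_complete_switch (S' : {set G}) c D z :
  partial_complete (S' : {set switch S}) c D z <->
  partial_complete (symdiff S' S) c D z.
Proof.
apply: (@partial_complete_image (switch S) G id) => //.
  by split=> [a|a b]; [exists a|split=> [ab|[_ [_ [<- <-]]]] //; exists a, b].
by move=> x y _ _ _; rewrite /switch_neg /= /switch_neg !inE addbACA !addbA.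
Qed.

End Switching.

Section Achromatic.
Variable G : sgraph.
Implicit Types (S : {set G}) (c : G -> nat) (D : seq nat) (z k : nat).

Lemma admits_completeP k : admits_complete G k <->
  exists S c, partial_complete S c (labels k) 0 /\ forall x, c x \in labels k.
Proof.
split=> [[S [phi /complete_colouringP[pc coloured]]]|[S [c [pc coloured]]]].
  move/partial_complete_switch in pc.
  by exists (symdiff [set v | (phi v < 0)%R] S), (fun v => `|phi v|%N).
exists S, (Posz \o c); apply/complete_colouringP; split=> //.
apply/partial_complete_switch; congr partial_complete: pc.
by apply/setP => x; rewrite !inE.
Qed.

Lemma psi_le m : (forall k, admits_complete G k -> k <= m) -> psi G <= m.
Proof. by move=> bound; apply/bigmax_leqP => k /andP[_ /asboolP /bound]. Qed.

Lemma psi_ge_ncol_coloured S c D z :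
  partial_complete S c D z -> (forall x, c x \in D) -> ncol D z <= psi G.
Proof.
move=> pc coloured; apply/psi_max/admits_completeP; have uD := pc_uniq pc.
pose r i := index i (z :: rem z D); have perm := perm_map_index_labels z uD.
exists S, (r \o c); split; last first.
  by move=> x; rewrite -(perm_mem perm); apply: (map_f r).
have -> : 0 = r z by rewrite /r /= eqxx.
apply: partial_complete_subset (partial_complete_relabel coloured _ pc).
- exact: iota_uniq.
- by move=> i; rewrite (perm_mem perm).
move=> i j iD jD; apply: (index_inj z); move: iD jD;
  rewrite !inE !mem_rem_uniq // !inE.
  by case: eqP.
by move=> _; case: eqP.
Qed.

End Achromatic.

Lemma psi_switch (G : sgraph) (S : {set G}) : psi (switch S) = psi G.
Proof.
apply/eqP; rewrite eqn_leq; apply/andP; split; apply: psi_le => k;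
  move=> /admits_completeP[S' [c [pc coloured]]]; apply/psi_max/admits_completeP.
- by exists (symdiff S' S), c; split=> //; apply/partial_complete_switch.
- exists (symdiff S' S), c; split=> //; apply/partial_complete_switch.
  by rewrite symdiffK.
Qed.

Section Extension.
Variables (G : sgraph) (S : {set G}) (c : G -> nat) (D : seq nat) (z : nat).
Variable v : G.
Hypotheses (pc : partial_complete S c D z) (cv : c v \notin D).

Definition sees (s : bool) (i : nat) : bool :=
  [exists w, [&& sg_adj v w, switch_neg S v w == s & c w == i]].

Lemma seesP s i :
  reflect (exists w, [/\ sg_adj v w, switch_neg S v w = s & c w = i]) (sees s i).
Proof.
apply: (iffP existsP) => -[w].
  by case/and3P=> vw /eqP sw /eqP cw; exists w.
by case=> vw sw cw; exists w; apply/and3P; split=> //; apply/eqP.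
Qed.

Lemma coloured_neq x : c x \in D -> x != v.
Proof. by apply: contraTneq => ->. Qed.

Lemma recoloured x i : c x \in D -> [eta c with v |-> i] x = c x.
Proof. by move=> /coloured_neq /negPf /= ->. Qed.

Lemma recoloured_nonempty i j : j \in D -> exists x, [eta c with v |-> i] x = j.
Proof.
by move=> /[dup] jD /(pc_nonempty pc)[x cx]; exists x; rewrite recoloured cx.
Qed.

Lemma sees_joined (S' : {set G}) s i j : i \in D ->
    (v \in S') = (v \in S) -> (forall w, c w = i -> (w \in S') = (w \in S)) ->
  sees s i -> joined S' [eta c with v |-> j] s j i.
Proof.
move=> iD S'v S'w /seesP[w [vw <- cw]]; have cwD : c w \in D by rewrite cw.
by exists v, w; rewrite (recoloured j cwD) /= eqxx /switch_neg S'v S'w.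
Qed.

Lemma proper_on_extend S' D' z' i :
    (forall w, sg_adj v w -> c w = i -> switch_neg S' v w && (i != z')) ->
    (forall x y, x != v -> y != v -> sg_adj x y -> c x = c y -> c x \in D' ->
       switch_neg S' x y && (c x != z')) ->
  proper_on S' [eta c with v |-> i] D' z'.
Proof.
move=> at_v off_v x y xy /=.
case: (eqVneq x v) xy => [->|xv] xy; case: (eqVneq y v) xy => [->|yv] xy.
- by rewrite sg_adj_irr in xy.
- by move=> iy _; apply: at_v.
- move=> xi _; rewrite switch_neg_sym // xi.
  by apply: at_v; rewrite // sg_adj_sym.
- exact: off_v.
Qed.

Lemma extend_class i b :
    i \in D -> ~~ sees b i -> (i == z -> ~~ sees (~~ b) i) ->
  exists S', partial_complete S' [eta c with v |-> i] D z.
Proof.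
move=> iD unseen zero_unseen; pose S' := [set x | (x \in S) (+) ((x == v) && b)].
have S'E x : x != v -> (x \in S') = (x \in S).
  by rewrite inE => /negPf ->; rewrite addbF.
have S'v : (v \in S') = (v \in S) (+) b by rewrite inE eqxx.
exists S'; split=> [|j|x y|s j l jD lD /(pc_joined pc jD lD)].
- exact: pc_uniq pc.
- exact: recoloured_nonempty.
- apply: proper_on_extend x y => [w vw cw|x y xv yv].
    have seen : sees (switch_neg S v w) i by apply/seesP; exists w.
    have sE : switch_neg S v w = ~~ b.
      apply: contraNeq unseen; move: seen.
      by case: (switch_neg S v w); case: (b).
    have -> : switch_neg S' v w = b (+) switch_neg S v w.
      rewrite /switch_neg S'v S'E ?coloured_neq ?cw //.
      by rewrite (addbC (v \in S)) !addbA.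
    by rewrite sE addbN addbb; apply: contraL seen => /zero_unseen; rewrite sE.
  by rewrite /switch_neg !S'E //; apply: (pc_proper pc).
- apply: eq_joined => x cx; have cxD : c x \in D by case: cx => ->.
  by rewrite recoloured // S'E // coloured_neq.
Qed.

(* Switching the vertices of the class [z] makes their edges to [v] negative, so
   that the class can absorb [v] and become a nonzero one.  *)
Lemma extend_zero_class z' b : z \in D -> z' \notin D -> sees b z ->
    (forall s i, i \in D -> i != z -> sees s i) ->
  exists S', partial_complete S' [eta c with v |-> z] D z'.
Proof.
move=> zD z'D sees_z sees_nz.
pose S' := [set x | if c x == z then ~~ ((v \in S) (+) sg_neg v x) else x \in S].
have S'E x : c x != z -> (x \in S') = (x \in S) by rewrite inE => /negPf ->.
have S'v : (v \in S') = (v \in S) by rewrite S'E //; apply: contraNneq cv => ->.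
have to_z w : c w = z -> switch_neg S' v w.
  move=> cw; rewrite /switch_neg S'v [w \in S']inE cw eqxx.
  by case: (v \in S); case: (sg_neg v w).
have from_v s i : i \in D -> i != z -> joined S' [eta c with v |-> z] s z i.
  move=> iD iz; apply: sees_joined (sees_nz s i iD iz) => // w cw.
  by rewrite S'E ?cw.
have nz' i : i \in D -> i != z' by move=> iD; apply: contraNneq z'D => <-.
exists S'; split=> [|j|x y|s i j iD jD].
- exact: pc_uniq pc.
- exact: recoloured_nonempty.
- apply: proper_on_extend x y => [w _ cw|x y _ _ xy cxy cx].
    by rewrite to_z ?nz'.
  have /andP[sxy cxz] := pc_proper pc xy cxy cx.
  by rewrite nz' // andbT /switch_neg !S'E // -cxy.
rewrite nz' // andbT => ij.
have [iz|iz] := eqVneq i z; have [jz|jz] := eqVneq j z.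
- have /seesP[w [vw _ cw]] := sees_z; have cwD : c w \in D by rewrite cw.
  exists v, w; rewrite (recoloured z cwD) /= eqxx to_z //.
  by split=> //; move: ij; rewrite iz jz eqxx.
- by rewrite iz; apply: from_v.
- by rewrite jz; apply/joinedC/from_v.
have : joined S c s i j.
  by apply: (pc_joined pc iD jD); rewrite iz andbT.
apply: eq_joined => x cx.
have [cxD cxz] : c x \in D /\ c x != z by case: cx => ->.
by rewrite recoloured // S'E.
Qed.

Lemma new_zero_class z' : z \notin D -> z' \notin codom c ->
    (forall s i, i \in D -> sees s i) ->
  partial_complete S [eta c with v |-> z'] (z' :: D) z'.
Proof.
move=> zD z'c sees_all.
have z'c_neq x : c x != z' by apply: contraNneq z'c => <-; apply: codom_f.
have z'D i : i \in D -> i != z' by move=> /(pc_nonempty pc)[x <-].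
have from_v s i : i \in D -> joined S [eta c with v |-> z'] s z' i.
  by move=> iD; apply: sees_joined (sees_all s i iD).
split=> [|j|x y|s i j].
- by rewrite /= (pc_uniq pc) andbT; apply/negP => /z'D; rewrite eqxx.
- rewrite inE => /predU1P[->|]; last exact: recoloured_nonempty.
  by exists v; rewrite /= eqxx.
- apply: proper_on_extend x y => [w _ /eqP|x y _ _ xy cxy].
    by rewrite (negPf (z'c_neq w)).
  rewrite inE (negPf (z'c_neq x)) andbT => /(pc_proper pc xy cxy).
  by case/andP.
- rewrite !inE => /predU1P[->|iD] /predU1P[->|jD].
  + by rewrite !eqxx andbF.
  + by move=> _; apply: from_v.
  + by move=> _; apply/joinedC/from_v.
  have iz : i != z by apply: contraNneq zD => <-.
  rewrite z'D // => ij; have : joined S c s i j.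
    by apply: (pc_joined pc iD jD); rewrite iz.
  apply: eq_joined => x cx; have cxD : c x \in D by case: cx => ->.
  by rewrite recoloured.
Qed.

Lemma coloured_vertices_proper (D' : seq nat) i : {subset D <= D'} -> i \in D' ->
  [set x | c x \in D] \proper [set x | [eta c with v |-> i] x \in D'].
Proof.
move=> sub iD'; apply/properP; split; last by exists v; rewrite !inE //= eqxx.
by apply/subsetP => x; rewrite !inE => cx; rewrite recoloured // sub.
Qed.

(* If [v] fits in no class, then it sees every nonzero class with both signs,
   and the zero class, if there is one, with some sign.  *)
Lemma extend_vertex : exists S' c' D' z',
  [/\ partial_complete S' c' D' z', ncol D z <= ncol D' z'
    & [set x | c x \in D] \proper [set x | c' x \in D']].
Proof.
pose fits b i := ~~ sees b i && ((i == z) ==> ~~ sees (~~ b) i).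
have [/hasP[i iD /existsP[b /andP[unseen /implyP zero_unseen]]]|/hasPn nofit] :=
  boolP (has (fun i => [exists b, fits b i]) D).
  have [S' pc'] := extend_class iD unseen zero_unseen.
  exists S', [eta c with v |-> i], D, z; split=> //.
  exact: coloured_vertices_proper.
have sees_or b i : i \in D -> sees b i || (i == z) && sees (~~ b) i.
  move=> /nofit /existsPn /(_ b).
  by rewrite negb_and negb_imply !negbK.
have sees_nz s i : i \in D -> i != z -> sees s i.
  by move=> iD /negPf iz; have := sees_or s i iD; rewrite iz orbF.
have [z' z'c] := exists_notin (codom c).
have z'D : z' \notin D.
  by apply: contra z'c => /(pc_nonempty pc)[x <-]; apply: codom_f.
have [zD|zD] := boolP (z \in D).
  have [b sees_z] : exists b, sees b z.
    have := sees_or true z zD; rewrite eqxx /=.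
    by case/orP; [exists true|exists false].
  have [S' pc'] := extend_zero_class zD z'D sees_z sees_nz.
  exists S', [eta c with v |-> z], D, z'; split=> //; first exact: ncol_le_notin.
  exact: coloured_vertices_proper.
exists S, [eta c with v |-> z'], (z' :: D), z'; split.
- apply: new_zero_class => // s i iD; apply: sees_nz => //.
  by apply: contraNneq zD => <-.
- apply: leq_trans (ncol_le_notin z z'D) _.
  by rewrite /ncol /= eqxx addSn leqnSn.
- apply: coloured_vertices_proper; last exact: mem_head.
  by move=> i iD; rewrite inE iD orbT.
Qed.

End Extension.

Lemma psi_ge_ncol (G : sgraph) (S : {set G}) c D z :
  partial_complete S c D z -> ncol D z <= psi G.
Proof.
have [n] := ubnP #|~: [set x | c x \in D]|.
elim: n S c D z => // n IHn S c D z ltn pc.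
have [/forallP coloured|] := boolP [forall x, c x \in D].
  exact: psi_ge_ncol_coloured pc coloured.
rewrite negb_forall => /existsP[v cv].
have [S' [c' [D' [z' [pc' le_ncol grows]]]]] := extend_vertex pc cv.
apply: leq_trans le_ncol (IHn _ _ _ _ _ pc').
by rewrite -ltnS; apply: leq_trans ltn; rewrite ltnS proper_card // properC.
Qed.

Section FullImage.
Variables (G H : sgraph) (f : G -> H).
Hypotheses (f_full : full_surjection f)
  (f_neg : forall x y, sg_adj x y -> sg_neg (f x) (f y) = sg_neg x y).

Lemma psi_full_image_le : psi H <= psi G.
Proof.
apply: psi_le => k /admits_completeP[S [c [pc _]]].
rewrite -(ncol_labels k); apply: (@psi_ge_ncol _ (f @^-1: S) (c \o f) _ 0).
apply: iffRL pc; apply: (partial_complete_image _ f_full) => // x y xy _ _.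
by rewrite /switch_neg !inE f_neg.
Qed.

Lemma psi_full_image_ge (W : {set G}) :
    (forall x y, f x = f y -> x != y -> (x \in W) && (y \in W)) ->
  psi G <= psi H + #|W|.*2.
Proof.
move=> f_inj; apply: psi_le => k /admits_completeP[S [c [pc _]]].
have [g gK] : exists g : H -> G, cancel g f.
  by case: f_full => /choice[g gK] _; exists g.
pose D' := [seq i <- labels k | i \notin image c W].
have WD' x : c x \in D' -> x \notin W.
  by rewrite mem_filter => /andP[cW _]; apply: contra cW; apply: image_f.
have fK x : (x \notin W) || (g (f x) \notin W) -> g (f x) = x.
  rewrite -negb_and; apply: contraNeq => gx.
  by rewrite andbC f_inj // gK.
have pcG : partial_complete S c D' 0.
  apply: partial_complete_subset pc; first by rewrite filter_uniq ?iota_uniq.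
  by move=> i; rewrite mem_filter => /andP[].
have /psi_ge_ncol psi_H_ge : partial_complete (g @^-1: S) (c \o g) D' 0.
  apply: iffLR pcG.
  apply: (partial_complete_image _ f_full) => [x y xy /WD' xW /WD' yW|x].
    by rewrite /switch_neg !inE f_neg // (fK x) ?xW // (fK y) ?yW.
  by case/orP => /WD' xW; rewrite /= fK // xW ?orbT.
have := ncol_le_filter_notin (image c W) 0 (iota_uniq (~~ odd k) (uphalf k)).
rewrite ncol_labels => k_le; apply: leq_trans k_le _.
by rewrite size_image leq_add2r.
Qed.

End FullImage.

Section ElementaryImage.
Variables (G H : sgraph) (u v : G) (f : G -> H).
Hypothesis f_ident : identification u v f.

Lemma identification_full : full_surjection f.
Proof. by case: f_ident. Qed.

Lemma identification_inj x y :
  f x = f y -> x != y -> (x \in [set u; v]) && (y \in [set u; v]).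
Proof.
case: f_ident => _ fibre _ _ /fibre fxy xy; rewrite !inE.
by case: fxy xy => [->|[-> ->]|[-> ->]]; rewrite !eqxx ?orbT.
Qed.

Lemma psi_identification : psi G - 4 <= psi H <= psi G.
Proof.
have f_neg : forall x y, sg_adj x y -> sg_neg (f x) (f y) = sg_neg x y.
  by case: f_ident.
have := psi_full_image_ge identification_full f_neg identification_inj.
rewrite (psi_full_image_le identification_full f_neg) andbT.
rewrite leq_subLR (addnC 4) => psi_G_le.
by apply: leq_trans psi_G_le _; rewrite leq_add2l cards2; case: (u != v).
Qed.

End ElementaryImage.

Lemma psi_elementary_image (G H : sgraph) :
  elementary_image G H -> psi G - 4 <= psi H <= psi G.
Proof.
case=> S [u [v [_ [f f_ident]]]].
by rewrite -(psi_switch S); apply: psi_identification f_ident.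
Qed.

Definition negative (G : sgraph) : Prop :=
  forall x y : G, sg_adj x y -> sg_neg x y.

Definition universal (G : sgraph) (x : G) : Prop :=
  forall y, y != x -> sg_adj x y.

Definition vertex_cover (G : sgraph) (K : {set G}) : Prop :=
  forall x y, sg_adj x y -> (x \in K) || (y \in K).

Section NegativeGraph.
Variables (G : sgraph) (K : {set G}) (t t' : G).
Hypotheses (G_neg : negative G) (K_cover : vertex_cover K).
Hypotheses (tK : t \in K) (t'K : t' \in K) (tt' : t != t').
Hypotheses (t_univ : universal t) (t'_univ : universal t').

Section Classes.
Variables (S : {set G}) (c : G -> nat) (D : seq nat) (z : nat).
Hypotheses (pc : partial_complete S c D z) (coloured : forall x, c x \in D).

Lemma same_side x y : sg_adj x y -> c x = c y -> (x \in S) = (y \in S).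
Proof.
move=> xy cxy; have /andP[+ _] := pc_proper pc xy cxy (coloured x).
rewrite /switch_neg (G_neg xy) addbT.
by move=> /negPn/eqP; case: (x \in S); case: (y \in S).
Qed.

(* All the vertices of the class of a universal vertex are on the same side of
   [S], so that all the edges between two such classes have the same sign.  *)
Lemma universal_same_class : c t = c t'.
Proof.
apply/eqP/negPn/negP => /negPf ctt'.
have side r x : universal r -> c x = c r -> (x \in S) = (r \in S).
  move=> r_univ cx; have [->//|xr] := eqVneq x r.
  by apply/esym/same_side => //; apply: r_univ.
have [|x [y [xy]]] := pc_joined pc (s := (t \in S) (+) (t' \in S))
  (coloured t) (coloured t'); first by rewrite ctt'.
move=> + cx cy; rewrite /switch_neg (G_neg xy) (side t x) // (side t' y) //.
by rewrite addbT; case: (_ (+) _).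
Qed.

Lemma vertex_cover_meets_class i : i \in D -> i != z ->
  exists x y, [/\ sg_adj x y, x \in K, c x = i & c y = i].
Proof.
move=> iD iz; have [|x [y [xy _ cx cy]]] := pc_joined pc (s := true) iD iD.
  by rewrite iz implybT.
have /orP[xK|yK] := K_cover xy; first by exists x, y.
by exists y, x; rewrite sg_adj_sym.
Qed.

Lemma nonzero_classes_sub_cover :
  {subset [seq i <- D | i != z] <= image c (K :\ t)}.
Proof.
move=> i; rewrite mem_filter => /andP[iz iD].
have [x [_ [_ xK cx _]]] := vertex_cover_meets_class iD iz.
have [xt|xt] := eqVneq x t; apply/imageP; last by exists x; rewrite ?inE ?xt.
by exists t'; rewrite ?inE 1?eq_sym ?tt' // -cx xt universal_same_class.
Qed.

Lemma count_nonzero_lt : count (predC1 z) D < #|K|.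
Proof.
rewrite (cardsD1 t K) tK ltnS -(size_image c) -size_filter.
apply: uniq_leq_size nonzero_classes_sub_cover.
exact: filter_uniq (pc_uniq pc).
Qed.

Lemma count_nonzero_max : count (predC1 z) D = #|K|.-1 ->
  {in K :\ t &, injective c} /\ {in K, forall x, c x != z}.
Proof.
move=> countE; pose N := [seq i <- D | i != z].
have uN : uniq N by apply: filter_uniq (pc_uniq pc).
have size_le : size (image c (K :\ t)) <= size N.
  by rewrite size_image size_filter countE (cardsD1 t K) tK.
have memN := (uniq_min_size uN nonzero_classes_sub_cover size_le).2.
split=> [|x xK].
  by apply/dinjectiveP/(leq_size_uniq uN nonzero_classes_sub_cover size_le).
suff : c x \in image c (K :\ t) by rewrite -memN mem_filter => /andP[].
have [->|xt] := eqVneq x t; last by rewrite image_f // !inE xt.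
by rewrite universal_same_class image_f // !inE eq_sym tt'.
Qed.

(* The class of [h] meets [K] in [h] only, and the zero class avoids [K], so
   that [h] needs a neighbour outside [K] in its own class and another one in the
   zero class.  *)
Lemma zero_notin_of_count_max h : h \in K -> h != t -> h != t' ->
    {in [predC K] &, forall x y, sg_adj h x -> sg_adj h y -> x = y} ->
  count (predC1 z) D = #|K|.-1 -> z \notin D.
Proof.
move=> hK ht ht' h_nbr /count_nonzero_max[c_inj K_nonzero]; apply/negP => zD.
have alone x : x \in K -> c x = c h -> x = h.
  move=> xK cx; have [xt|xt] := eqVneq x t; last first.
    by apply: c_inj; rewrite // !inE ?xt ?ht.
  have /eqP := ht'; case; apply: c_inj; rewrite ?inE ?ht ?(eq_sym t') ?tt' //.
  by rewrite -universal_same_class -xt.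
have [x [y [xy xK cx cy]]] :=
  vertex_cover_meets_class (coloured h) (K_nonzero h hK).
have [|a [b [ab _ ca cb]]] := pc_joined pc (s := true) (coloured h) zD.
  by rewrite (negPf (K_nonzero h hK)).
have xh : x = h by apply: alone.
have yK : y \notin K.
  by apply: contraTN xy => /alone -> //; rewrite xh sg_adj_irr.
have bK : b \notin K by apply/negP => /K_nonzero; rewrite cb eqxx.
have ah : a = h.
  by apply: alone => //; have := K_cover ab; rewrite (negPf bK) orbF.
have /eqP : c y = c b by rewrite (h_nbr y b) // -?xh // xh -ah.
by rewrite cy cb (negPf (K_nonzero h hK)).
Qed.

End Classes.

Lemma psi_negative_cover_le : psi G <= (#|K|.-1).*2.+1.
Proof.
apply: psi_le => k /admits_completeP[S [c [pc coloured]]].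
by have := count_nonzero_lt pc coloured; rewrite count_labels; lia.
Qed.

Lemma psi_negative_cover_le_even h : h \in K -> h != t -> h != t' ->
    {in [predC K] &, forall x y, sg_adj h x -> sg_adj h y -> x = y} ->
  psi G <= (#|K|.-1).*2.
Proof.
move=> hK ht ht' h_nbr; apply: psi_le => k.
move=> /admits_completeP[S [c [pc coloured]]].
have := count_nonzero_lt pc coloured.
have := zero_notin_of_count_max pc coloured hK ht ht' h_nbr.
by rewrite count_labels mem_labels /=; lia.
Qed.

End NegativeGraph.

Section Contraction.
Variables (G : sgraph) (u v : G).
Hypotheses (uv : u != v) (uv_nadj : ~~ sg_adj u v).
Notation V := {x : G | x != v}.

Definition merge (x : G) : V := insubd (exist _ u uv) x.

Lemma val_merge x : val (merge x) = if x != v then x else u.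
Proof. by rewrite /merge val_insubd; case: (x != v). Qed.

Lemma merge_val (a : V) : merge (val a) = a.
Proof. exact: valKd. Qed.

Lemma merge_eq x y :
  merge x = merge y <-> [\/ x = y, x = u /\ y = v | x = v /\ y = u].
Proof.
split=> [/(congr1 val)|[->|[-> ->]|[-> ->]]] //; last first.
- by apply: val_inj; rewrite !val_merge eqxx uv.
- by apply: val_inj; rewrite !val_merge eqxx uv.
rewrite !val_merge.
have [->|xv] := eqVneq x v; have [->|yv] := eqVneq y v => /= xy.
- by constructor 1.
- by constructor 3.
- by constructor 2.
- by constructor 1.
Qed.

Lemma merge_inj : {in predC1 v &, injective merge}.
Proof.
move=> x y; rewrite !inE => xv yv /(congr1 val).
by rewrite !val_merge xv yv.
Qed.

Definition contract_adj (a b : V) : bool :=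
  [exists x, exists y, [&& merge x == a, merge y == b & sg_adj x y]].

Lemma contract_adjP a b :
  reflect (exists x y, [/\ merge x = a, merge y = b & sg_adj x y])
    (contract_adj a b).
Proof.
apply: (iffP existsP) => -[x].
  by case/existsP=> y /and3P[/eqP xa /eqP yb xy]; exists x, y.
case=> y [xa yb xy]; exists x; apply/existsP; exists y.
by apply/and3P; split=> //; apply/eqP.
Qed.

Lemma contract_adj_sym : symmetric contract_adj.
Proof.
by move=> a b; apply/contract_adjP/contract_adjP => -[x [y [xa yb xy]]];
  exists y, x; rewrite sg_adj_sym.
Qed.

Lemma contract_adj_irr : irreflexive contract_adj.
Proof.
move=> a; apply/contract_adjP => -[x [y [<- /esym/merge_eq]]].
by case=> [->|[-> ->]|[-> ->]]; apply/negP; rewrite ?sg_adj_irr // sg_adj_sym.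
Qed.

Definition negative_contraction : sgraph :=
  @SGraph V contract_adj (fun _ _ => true) contract_adj_sym contract_adj_irr
    (fun _ _ _ => erefl).

Lemma negative_contraction_elementary_image :
  negative G -> elementary_image G negative_contraction.
Proof.
move=> G_neg; exists set0, u, v; split.
  split=> //; first by constructor.
  by move=> w uw vw; rewrite /switch_neg !inE !G_neg.
exists merge; split=> [a||a b|x y xy].
- by exists (val a); apply: merge_val.
- exact: merge_eq.
- by split=> /contract_adjP.
- by rewrite /= /switch_neg !inE G_neg.
Qed.

Lemma negative_contraction_universal x :
    (forall y, merge y != merge x ->
       exists2 x', merge x' = merge x & sg_adj x' y) ->
  universal (merge x : negative_contraction).
Proof.
move=> adj b; rewrite -[b]merge_val => /adj[x' x'x x'b].
by apply/contract_adjP; exists x', (val b).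
Qed.

End Contraction.

Variant vertex (p : nat) : Type :=
  | Hub of 'I_p.+4 | Loop of 'I_p.+4 | Link of 'I_p.+3 | Zero of bool.

Arguments Zero {p}.

Definition vertex_code p (x : vertex p) :
    'I_p.+4 + 'I_p.+4 + ('I_p.+3 + bool) :=
  match x with
  | Hub q => inl (inl q)
  | Loop q => inl (inr q)
  | Link q => inr (inl q)
  | Zero s => inr (inr s)
  end.

Definition vertex_decode p
    (x : 'I_p.+4 + 'I_p.+4 + ('I_p.+3 + bool)) : vertex p :=
  match x with
  | inl (inl q) => Hub q
  | inl (inr q) => Loop q
  | inr (inl q) => Link q
  | inr (inr s) => Zero s
  end.

Lemma vertex_codeK p : cancel (@vertex_code p) (@vertex_decode p).
Proof. by case. Qed.

HB.instance Definition _ p :=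
  Finite.copy (vertex p) (can_type (@vertex_codeK p)).

Section Extremal.
Variables (p : nat) (b : bool).

(* The class q+1 consists of [Hub q], [Loop q] and, on the other side, [Link q]:
   [Loop q] gives the edge inside the class and [Link q] the positive edges to
   the hubs of the later classes.  The two vertices [Zero s] form the zero class
   when [b] holds.  The hubs p+1, p+2 and p+3 are adjacent to all the other
   vertices, except that p+1 and p+2 are adjacent neither to each other nor to
   their own links; these are the two vertices to be identified.  *)
Definition arc (x y : vertex p) : bool :=
  match x, y with
  | Hub q, Hub r => (q < r) && ~~ ((p < q) && (r < p.+3))
  | Hub q, Loop r => (q == r) || (p < q)
  | Hub q, Link r => (r < q) || (p < q) && (r != q :> nat)
  | Hub q, Zero _ => b || (p < q)
  | _, _ => false
  end.

Definition extremal_adj (x y : vertex p) : bool := arc x y || arc y x.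

Lemma extremal_adj_sym : symmetric extremal_adj.
Proof. by move=> x y; rewrite /extremal_adj orbC. Qed.

Lemma extremal_adj_irr : irreflexive extremal_adj.
Proof. by case=> // q; rewrite /extremal_adj /= ltnn. Qed.

Definition extremal : sgraph :=
  @SGraph (vertex p) extremal_adj (fun _ _ => true)
    extremal_adj_sym extremal_adj_irr (fun _ _ _ => erefl).

Definition extremal_side : {set extremal} :=
  [set x | if x is (Link _ | Zero true) then true else false].

Definition extremal_label (x : extremal) : nat :=
  match x with
  | Hub q | Loop q => q.+1
  | Link q => q.+1
  | Zero _ => 0
  end.

Lemma extremal_proper D : proper_on extremal_side extremal_label D 0.
Proof.
case=> [q|q|q|s] [r|r|r|s'] //= adj eq_label _; rewrite /switch_neg !inE //=;
  by move: adj eq_label; rewrite /extremal_adj /=; lia.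
Qed.

Lemma extremal_joined_zero s (q : 'I_p.+4) :
  b -> joined extremal_side extremal_label s 0 q.+1.
Proof.
move=> bT; exists (Zero (~~ s)), (Hub q).
by rewrite /= /extremal_adj /= bT /switch_neg !inE; split=> //; case: s.
Qed.

Lemma extremal_joined_lt s (q r : 'I_p.+4) :
  q < r -> joined extremal_side extremal_label s q.+1 r.+1.
Proof.
move=> qr; case: s; last first.
  have qp : q < p.+3 by rewrite (leq_trans qr) // -ltnS.
  exists (Link (Ordinal qp)), (Hub r).
  by rewrite /= /extremal_adj /= qr /switch_neg !inE.
exists (Hub q), (if (p < q) && (r < p.+3) then Loop r else Hub r).
rewrite /= /extremal_adj /switch_neg !inE; case: ifPn => [/andP[pq _]|uv] /=.
  by rewrite pq orbT.
by rewrite qr uv.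
Qed.

Lemma extremal_complete :
  partial_complete extremal_side extremal_label (labels ((p.+4).*2 + b)) 0.
Proof.
have labelP i : i \in labels ((p.+4).*2 + b) ->
    i = 0 /\ b \/ exists q : 'I_p.+4, i = q.+1.
  rewrite mem_labels; case: i => [|i] ip; [left|right].
    by split=> //; lia.
  have ltip : i < p.+4 by lia.
  by exists (Ordinal ltip).
split=> [|_ /labelP[[-> _]|[q ->]]||
  s _ _ /labelP[[-> ?]|[q ->]] /labelP[[-> ?]|[r ->]]].
- exact: iota_uniq.
- by exists (Zero true).
- by exists (Hub q).
- exact: extremal_proper.
- by rewrite eqxx andbF.
- by move=> _; apply: extremal_joined_zero.
- by move=> _; apply/joinedC/extremal_joined_zero.
rewrite eqSS andbT; case: ltngtP => [qr _|rq _|/ord_inj -> /= ->].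
- exact: extremal_joined_lt.
- exact/joinedC/extremal_joined_lt.
- by exists (Hub r), (Loop r); rewrite /= /extremal_adj /= eqxx /switch_neg !inE.
Qed.

Lemma psi_extremal_ge : (p.+4).*2 + b <= psi extremal.
Proof. by have := psi_ge_ncol extremal_complete; rewrite ncol_labels. Qed.

Let lt_v : p.+2 < p.+4 := ltnW (ltnSn p.+3).
Let u : extremal := Hub (Ordinal (ltnW lt_v)).
Let v : extremal := Hub (Ordinal lt_v).
Let top : extremal := Hub ord_max.
Let first : extremal := Hub ord0.

Lemma Hub_eqE (q r : 'I_p.+4) : (Hub q == Hub r :> extremal) = (q == r :> nat).
Proof. by apply/eqP/eqP => [[->]|/ord_inj ->]. Qed.

Lemma uv_neq : u != v.
Proof. by rewrite Hub_eqE /=; lia. Qed.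

Lemma uv_nadj : ~~ sg_adj u v.
Proof. by rewrite /= /extremal_adj /=; lia. Qed.

Definition extremal_image : sgraph := negative_contraction uv_neq uv_nadj.

Local Notation proj := (merge uv_neq : extremal -> extremal_image).

Lemma extremal_image_elementary : elementary_image extremal extremal_image.
Proof. exact: negative_contraction_elementary_image. Qed.

Lemma uv_dominating y : y != u -> y != v -> sg_adj u y || sg_adj v y.
Proof.
by case: y => [q|q|q|s]; rewrite /= /extremal_adj ?Hub_eqE /=;
  try have := ltn_ord q; lia.
Qed.

Lemma top_universal : universal top.
Proof.
by case=> [q|q|q|s]; rewrite /= /extremal_adj ?Hub_eqE /=;
  try have := ltn_ord q; lia.
Qed.

Lemma proj_u_universal : universal (proj u).
Proof.
apply: negative_contraction_universal => y yu.
have vu : proj v = proj u by apply/merge_eq; constructor 3.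
have /orP[uy|vy] : sg_adj u y || sg_adj v y.
  by apply: uv_dominating; apply: contraNneq yu => ->; rewrite ?vu.
- by exists u.
- by exists v.
Qed.

Lemma proj_top_universal : universal (proj top).
Proof.
apply: negative_contraction_universal => y ytop; exists top => //.
by apply: top_universal; apply: contraNneq ytop => ->.
Qed.

Definition is_hub (x : extremal) : bool := if x is Hub _ then true else false.

Definition hubs : {set extremal_image} := [set a | is_hub (val a)].

Lemma proj_hubs x : (proj x \in hubs) = is_hub x.
Proof. by rewrite inE val_merge; case: eqP => // ->. Qed.

Lemma hubs_cover : vertex_cover hubs.
Proof.
move=> _ _ /contract_adjP[x [y [<- <- xy]]]; rewrite !proj_hubs.
by case: x y xy => [q|q|q|s] [r|r|r|s'].
Qed.

Lemma card_hubs : #|hubs| <= p.+3.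
Proof.
pose all_hubs : {set extremal} := [set Hub q | q : 'I_p.+4].
have all_hubs_card : #|all_hubs| = p.+4.
  by rewrite card_imset ?card_ord // => q r [].
rewrite -(card_imset _ val_inj) -ltnS -all_hubs_card (cardsD1 v all_hubs).
rewrite imset_f // add1n ltnS subset_leq_card //.
apply/subsetP => _ /imsetP[a + ->]; rewrite !inE (valP a) /=.
by case: (val a) => // q _; rewrite imset_f.
Qed.

Lemma first_nonhub_neighbour x : ~~ b ->
  x \notin hubs -> sg_adj (proj first) x -> x = proj (Loop ord0).
Proof.
move=> bF xK /contract_adjP[y [z [yfirst zx yz]]]; rewrite -{x}zx in xK *.
rewrite proj_hubs in xK; congr merge.
have yE : y = first.
  by case/merge_eq: yfirst => [//|[_ /eqP]|[_ /eqP]]; rewrite Hub_eqE.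
move: yz xK; rewrite {}yE.
case: z => [q|q|q|s] //=; rewrite /extremal_adj /= ?(negPf bF) //.
by rewrite !orbF => /eqP <-.
Qed.

Lemma psi_extremal_image_le : psi extremal_image <= (p.+2).*2 + b.
Proof.
have negative_image : negative extremal_image by [].
have proj_neq (q r : 'I_p.+4) :
    [&& q != p.+2 :> nat, r != p.+2 :> nat & q != r :> nat] ->
    proj (Hub q) != proj (Hub r).
  move=> /and3P[qv rv qr].
  by rewrite (inj_in_eq (@merge_inj _ _ _ uv_neq)) ?inE Hub_eqE.
have [uK topK firstK] :
    [/\ proj u \in hubs, proj top \in hubs & proj first \in hubs].
  by rewrite !proj_hubs.
have u_top : proj u != proj top by apply: proj_neq; rewrite /=; lia.
have := card_hubs; case: (boolP b) => [bT|bF] card_le.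
  have := psi_negative_cover_le negative_image hubs_cover uK topK u_top
    proj_u_universal proj_top_universal.
  lia.
have := psi_negative_cover_le_even negative_image hubs_cover uK topK u_top
  proj_u_universal proj_top_universal firstK.
have first_u : proj first != proj u by apply: proj_neq; rewrite /=; lia.
have first_top : proj first != proj top by apply: proj_neq; rewrite /=; lia.
move=> /(_ first_u first_top) psi_le_even.
apply: leq_trans (psi_le_even _) _; last by lia.
move=> x y xK yK /(first_nonhub_neighbour bF xK)->.
by move=> /(first_nonhub_neighbour bF yK)->.
Qed.

End Extremal.

Theorem theorem3p10 :
  (forall G H : sgraph, elementary_image G H ->
     psi G - 4 <= psi H <= psi G) /\
  (forall k : nat, 8 <= k ->
     exists G H : sgraph,
       [/\ psi G = k, elementary_image G H & psi H = k - 4]).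
Proof.
split=> [G H|k k8]; first exact: psi_elementary_image.
pose p := k./2 - 4; have kE := odd_double_half k.
have image := @extremal_image_elementary p (odd k).
have lower := psi_extremal_ge p (odd k).
have upper := psi_extremal_image_le p (odd k).
have /andP[] := psi_elementary_image image.
by exists (extremal p (odd k)), (extremal_image p (odd k)); split=> //; lia.
Qed.
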